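(* Let $\mathbb{F}_q$ be a finite field with $q$ odd and $q\equiv 1\pmod 3$, let $a,b\in\mathbb{F}_q^*$ and let $n\ge 1$ be an integer. The number of rational points over $\mathbb{F}_{q^n}$ of the curve $\mathcal{C}: y^3=ax^6+b$ satisfies $$N_n(\mathcal{C})=q^n+1-\omega_1^n-\overline{\omega_1}^{\,n}-\omega_2^n-\overline{\omega_2}^{\,n}-\omega_3^n-\overline{\omega_3}^{\,n}-\omega_4^n-\overline{\omega_4}^{\,n}-\chi_3(a)-\chi_3^2(a),$$ where $\omega_1:=\omega_q(a^{-1},0,0,-ba^{-1})$, $\omega_2:=\omega_q(b^{-1},0,0,-ab^{-1})$, $\omega_3:=\omega_q(1,0,0,-4ab)$ and $\omega_4:=\omega_q(-4ab,0,0,1)$.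
   Context: For a plane curve $\mathcal{C}$ given by an affine equation over $\mathbb{F}_q$, $N_n(\mathcal{C})$ denotes the number of $\mathbb{F}_{q^n}$-rational points of its projective closure in $\mathbb{P}^2$ (the zero set of the homogenized equation); points at infinity are counted. $\chi_3$ denotes a multiplicative character of order $3$ on $\mathbb{F}_{q^n}^*$ (dependence on $n$ left implicit), extended by $\chi_3(0)=0$. For $q$ odd and $a\neq0,b,c,d\in\mathbb{F}_q$ such that $ax^3+bx^2+cx+d$ has distinct roots, $\omega_q(a,b,c,d)$ denotes the complex number $\omega$, unique up to conjugation and chosen with nonnegative imaginary part, such that $|\omega|=\sqrt q$ and the elliptic curve $y^2=ax^3+bx^2+cx+d$ has exactly $q^n+1-\omega^n-\overline{\omega}^{\,n}$ points over $\mathbb{F}_{q^n}$ (point at infinity included) for all $n\ge1$. *)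

(* Defs.v *)
From HB Require Import structures.
From mathcomp Require Import all_boot all_order all_algebra.
From mathcomp Require Import all_fingroup all_field all_character.
From mathcomp Require Import mpoly.

Set Implicit Arguments.
Unset Strict Implicit.
Unset Printing Implicit Defensive.

Import Order.TTheory GRing.Theory Num.Theory.
Local Open Scope ring_scope.

(* The homogenizing variable is the last one; lift ord_max i has value i. *)
Definition homogenize (K : fieldType) (k : nat) (f : {mpoly K[k]}) :
    {mpoly K[k.+1]} :=
  \sum_(m <- msupp f)
    f@_m *: ((\prod_(i < k) 'X_(lift ord_max i) ^+ m i)
             * 'X_ord_max ^+ ((msize f).-1 - mdeg m)).

(* A point of P^2(L) is the set of its vectors of homogeneous coordinates,
   that is, the orbit of a nonzero vector under scaling by L^*. *)
Definition proj_point (L : finFieldType) (v : 'rV[L]_3) : {set 'rV[L]_3} :=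
  [set c *: v | c : L & c != 0].

Definition on_closure (F : fieldType) (L : finFieldType)
    (iota : {rmorphism F -> L}) (f : {mpoly F[2]}) (v : 'rV[L]_3) : bool :=
  (map_mpoly iota (homogenize f)).@[fun i => v ord0 i] == 0.

(* Number of L-rational points of the projective closure of f = 0, where L is
   an extension of F by iota: when #|L| = #|F| ^ n, this is N_n. *)
Definition num_points (F : fieldType) (L : finFieldType)
    (iota : {rmorphism F -> L}) (f : {mpoly F[2]}) : nat :=
  #|[set proj_point v | v : 'rV[L]_3 & (v != 0) && on_closure iota f v]|.

(* y^2 = a x^3 + b x^2 + c x + d, with x = 'X_ord0 and y = 'X_ord_max *)
Definition cubic_curve (F : fieldType) (a b c d : F) : {mpoly F[2]} :=
  'X_ord_max ^+ 2
  - (a *: 'X_ord0 ^+ 3 + b *: 'X_ord0 ^+ 2 + c *: 'X_ord0 + d%:MP).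

(* y^3 = a x^6 + b *)
Definition sextic_curve (F : fieldType) (a b : F) : {mpoly F[2]} :=
  'X_ord_max ^+ 3 - (a *: 'X_ord0 ^+ 6 + b%:MP).

(* w = omega_q(a, b, c, d) for q = #|F|. By Hasse's theorem there is exactly one
   such w when q is odd, a != 0 and the cubic has distinct roots. It is
   algebraic, being a root of X^2 - (w + w^* ) X + q with w + w^* an integer. *)
Definition is_omega (F : finFieldType) (a b c d : F) (w : algC) : Prop :=
  [/\ `|w| = sqrtC #|F|%:R,
      0 <= 'Im w
    & forall (n : nat) (L : finFieldType) (iota : {rmorphism F -> L}),
        (0 < n)%N -> #|L| = (#|F| ^ n)%N ->
        (num_points iota (cubic_curve a b c d))%:R
          = (#|F| ^ n)%:R + 1 - w ^+ n - w^* ^+ n].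

(* Extension by zero to L of a function on L^*. *)
Definition char_ext (L : finFieldType) (chi : 'CF([set: {unit L}])) (x : L) :
    algC :=
  if insub x is Some u then chi u else 0.

(* Main.v *)
Require Import Defs.
From HB Require Import structures.
From mathcomp Require Import all_boot all_order all_algebra.
From mathcomp Require Import all_fingroup all_solvable all_field all_character.
From mathcomp Require Import mpoly ring.

(** Write nroots d t for the number of d-th roots of t in the field L of Q
    elements, and c = 4ab. Each curve involved has a single point at infinity,
    because its top-degree form is a multiple of a power of x
    ([num_points_affine]), so the theorem is a relation between affine counts,
      C  = sum_x nroots 3 (a x^6 + b),
      E1 = sum_y nroots 3 (a y^2 + b),   E2 = sum_y nroots 3 (b y^2 + a),
      E3 = sum_x nroots 2 (x^3 - c),     E4 = sum_x nroots 2 (1 - c x^3),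
    where E1 and E2 arise because the first two cubics can be solved for x^3 as
    well as for y^2 ([num_points_cubic_inv]). The relation to be proved is
      C = E1 + E2 + E3 + E4 - 3Q + 1 - nroots 3 a.

    The arithmetic input is [nroots_char]: nroots d = sum_(j < d) chi^j for
    a multiplicative character chi of order d. For d = 3 it turns a product
    nroots 3 s * nroots 3 u into a sum of values at s, u, u/s and u/s^2
    ([nroots3M]); for d = 2 it says that nroots 2 - 1 is multiplicative.

    Putting s = x^3 gives C = sum_s nroots 3 s * nroots 3 (a s^2 + b). Expand
    each product with s <> 0. The terms at s are counted at once, those at
    u = a s^2 + b give E1, the product at s = 0 filling the gap, and those at
    u/s^2 = a + b/s^2 give E2 less its value nroots 3 a at 1/s = 0. The terms at
    u/s count the solutions of w^3 s = a s^2 + b, a quadratic equation in s of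
    discriminant w^6 - c, so their sum is T = sum_w nroots 2 (w^6 - c)
    ([sum_nroots3_div]). Finally y^2 = w^6 - c maps to y^2 = v^3 - c by v = w^2,
    and the twist of the latter by the quadratic character becomes
    y^2 = 1 - c x^3 under x = 1/v; hence T = E3 + E4 - Q - 1 ([sum_nroots2_sextic]). *)

Set Implicit Arguments.
Unset Strict Implicit.
Unset Printing Implicit Defensive.

Import Order.TTheory GRing.Theory Num.Theory.
Local Open Scope ring_scope.

(** * Multiplicative characters of a finite field *)

Lemma char_ext_unit (L : finFieldType) (chi : 'CF([set: {unit L}]))
    (u : {unit L}) :
  char_ext chi (val u) = chi u.
Proof. by rewrite /char_ext valK. Qed.

Lemma char_ext0 (L : finFieldType) (chi : 'CF([set: {unit L}])) :
  char_ext chi 0 = 0.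
Proof. by rewrite /char_ext insubF // unitr0. Qed.

Lemma unit_lift (L : finFieldType) (x : L) :
  x != 0 -> exists u : {unit L}, x = val u.
Proof. by rewrite -unitfE => x_unit; exists (FinRing.Unit x_unit). Qed.

Lemma char_extM (L : finFieldType) (chi : 'CF([set: {unit L}])) :
  chi \is a linear_char -> {morph char_ext chi : x y / x * y}.
Proof.
move=> chi_lin x y.
have [->|x0] := eqVneq x 0; first by rewrite mul0r char_ext0 mul0r.
have [->|y0] := eqVneq y 0; first by rewrite mulr0 char_ext0 mulr0.
have [[u ->] [v ->]] := (unit_lift x0, unit_lift y0).
rewrite -[val u * val v]/(val (u * v)%g) !char_ext_unit.
by rewrite lin_charM ?inE.
Qed.

Lemma char_ext1 (L : finFieldType) (chi : 'CF([set: {unit L}])) :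
  chi \is a linear_char -> char_ext chi 1 = 1.
Proof.
by move=> chi_lin; rewrite -[1]/(val (1%g : {unit L})) char_ext_unit lin_char1.
Qed.

Lemma char_extX (L : finFieldType) (chi : 'CF([set: {unit L}])) (n : nat) :
  chi \is a linear_char -> {morph char_ext chi : x / x ^+ n}.
Proof.
move=> chi_lin; elim: n => [|n IHn] x; first by rewrite !expr0 char_ext1.
by rewrite !exprS char_extM // IHn.
Qed.

Lemma char_ext_order (L : finFieldType) (chi : 'CF([set: {unit L}])) (x : L) :
  chi \is a linear_char -> x != 0 -> char_ext chi x ^+ #[chi]%CF = 1.
Proof.
move=> chi_lin /unit_lift[u ->]; rewrite char_ext_unit.
by apply: (dvdn_cforderP (dvdnn _)); rewrite inE.
Qed.

Lemma unit_expf_card (L : finFieldType) (x : L) :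
  x != 0 -> x ^+ #|L|.-1 = 1.
Proof.
move=> x0; apply: (mulfI x0); rewrite -exprS prednK ?expf_card ?mulr1 //.
exact: ltnW (finNzRing_gt1 L).
Qed.

Lemma primitive_element (L : finFieldType) :
  exists g : L, #|L|.-1.-primitive_root g.
Proof.
pose rs := [seq x <- enum L | x != 0].
have size_rs : size rs = #|L|.-1.
  rewrite -(cardC1 (0 : L)) cardE /rs -filter_predI size_filter /enum_mem.
  by rewrite size_filter; apply: eq_count => x; rewrite !inE andbT.
have : has #|L|.-1.-primitive_root rs.
  apply: cyclic.has_prim_root; rewrite ?size_rs //.
  - by rewrite -ltnS prednK ?finNzRing_gt1 // ltnW ?finNzRing_gt1.
  - apply/allP=> x; rewrite mem_filter => /andP[x0 _].
    by rewrite unity_rootE unit_expf_card.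
  - by rewrite filter_uniq ?enum_uniq.
by case/hasP=> g _; exists g.
Qed.

(** * Counting roots with characters *)

(** The values are taken in algC, where they are compared with characters. *)
Definition nroots (L : finFieldType) (d : nat) (t : L) : algC :=
  #|[set y : L | y ^+ d == t]|%:R.

Lemma nroots0 (L : finFieldType) (d : nat) :
  (0 < d)%N -> nroots d (0 : L) = 1.
Proof.
move=> d_gt0; rewrite /nroots (_ : [set _ | _] = [set 0]) ?cards1 //.
by apply/setP=> y; rewrite !inE expf_eq0 d_gt0.
Qed.

(** The roots are the translates of y by the d-th roots of unity, all d of which
    lie in L because d divides the order of the cyclic group of units. *)
Lemma nroots_power (L : finFieldType) (d : nat) (y : L) :
  (d %| #|L|.-1)%N -> y != 0 -> nroots d (y ^+ d) = d%:R.
Proof.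
move=> d_dvd y0; have [g prim_g] := primitive_element L.
have := dvdn_prim_root prim_g d_dvd; set z := g ^+ _ => prim_z; rewrite /nroots.
rewrite (_ : [set _ | _] = [set y * z ^+ (i : 'I_d) | i : 'I_d]).
  rewrite card_imset ?card_ord // => i j /(mulfI y0)/eqP.
  by rewrite (eq_prim_root_expr prim_z) !modn_small // => /eqP/val_inj.
apply/setP=> x; rewrite inE; apply/eqP/imsetP=> [xy|[i _ ->]].
  have [|i x_i] := prim_rootP prim_z (x := x / y).
    by rewrite expr_div_n xy divff ?expf_neq0.
  by exists i => //; rewrite -x_i mulrCA divff ?mulr1.
by rewrite exprMn exprAC (prim_expr_order prim_z) expr1n mulr1.
Qed.

(** Orthogonality of characters. If chi t <> 1 then t is no d-th power and the
    geometric sum vanishes; if chi t = 1 then t is a d-th power, since chi is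
    faithful on the cyclic quotient of the units by the d-th powers. At t = 0
    only the term j = 0 survives, as 0 ^+ 0 = 1. *)
Lemma nroots_char (L : finFieldType) (chi : 'CF([set: {unit L}])) (t : L) :
  chi \is a linear_char ->
  nroots #[chi]%CF t = \sum_(j < #[chi]%CF) char_ext chi t ^+ j.
Proof.
move=> chi_lin; set d := #[chi]%CF.
have d_gt0 : (0 < d)%N by exact: cforder_lin_char_gt0.
have [->|t0] := eqVneq t 0.
  rewrite nroots0 // char_ext0 -(prednK d_gt0) big_ord_recl expr0.
  rewrite big1 ?addr0 //.
  by move=> i _; rewrite exprS mul0r.
have d_dvd : (d %| #|L|.-1)%N.
  by rewrite -card_finField_unit; exact: cforder_lin_char_dvdG.
have [chit1|chitN1] := eqVneq (char_ext chi t) 1; last first.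
  have /eqP := char_ext_order chi_lin t0.
  rewrite -subr_eq0 subrX1 mulf_eq0 subr_eq0 (negPf chitN1) /= => /eqP->.
  rewrite /nroots (_ : [set _ | _] = set0) ?cards0 //; apply/setP=> y.
  rewrite !inE; apply/negP=> /eqP yt; case/eqP: chitN1.
  rewrite -yt char_extX // char_ext_order //.
  by apply: contra_neq t0 => y0; rewrite -yt y0 expr0n eqn0Ngt d_gt0.
rewrite chit1 (eq_bigr (fun=> 1)) => [|i _]; last by rewrite expr1n.
rewrite sumr_const card_ord; have [g prim_g] := primitive_element L.
have [k t_k] := prim_rootP prim_g (unit_expf_card t0).
(* As t = g ^+ k, the character chi ^+ k is trivial at the generator g. *)
suff /dvdnP[m k_m] : (d %| k)%N.
  rewrite t_k k_m exprM nroots_power //; apply: contra_neq t0 => gm0.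
  by rewrite t_k k_m exprM gm0 expr0n eqn0Ngt d_gt0.
apply/dvdn_cforderP=> u _; rewrite -char_ext_unit -char_extX //.
have [|j ->] := prim_rootP prim_g (x := val u).
  by rewrite unit_expf_card // -unitfE; exact: (valP u).
by rewrite exprAC -t_k char_extX // chit1 expr1n.
Qed.

(** The dual of the abelian group of units has even order Q - 1, hence contains
    an element of order 2 by Cauchy's theorem. *)
Lemma quadratic_char_exists (L : finFieldType) :
  odd #|L| ->
  exists2 chi : 'CF([set: {unit L}]), chi \is a linear_char & #[chi]%CF = 2%N.
Proof.
move=> L_odd.
have [linG [cF [_ cardG cF_lin _] [_ _ _ _ cF_order]]] :=
  lin_char_group [set: {unit L}]%G.
have abG : abelian [set: {unit L}].
  by apply/centsP=> u _ v _; apply: val_inj; exact: mulrC.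
have : (2 %| #|[set: linG]|)%N.
  rewrite cardsT cardG (derG1P abG) indexg1 card_finField_unit dvdn2.
  by move: L_odd; rewrite -[X in odd X](prednK (ltnW (finNzRing_gt1 L))).
by case/(Cauchy (isT : prime 2))=> u _ u2; exists (cF u); rewrite ?cF_order.
Qed.

Lemma odd_card_dvd2 (L : finFieldType) : odd #|L| -> (2 %| #|L|.-1)%N.
Proof. by rewrite dvdn2; case: #|L|. Qed.

Lemma natf2_neq0 (L : finFieldType) : odd #|L| -> 2%:R != 0 :> L.
Proof.
have [g prim_g] := primitive_element L.
by move/odd_card_dvd2; exact: (prim_root_dvd_eq0 prim_g).
Qed.

(** nroots 2 - 1 is the quadratic character of L. *)
Lemma nroots2M (L : finFieldType) (u v : L) :
  odd #|L| ->
  nroots 2 (u * v) - 1 = (nroots 2 u - 1) * (nroots 2 v - 1).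
Proof.
move=> L_odd; have [chi chi_lin chi2] := quadratic_char_exists L_odd.
have n2E t : nroots 2 t - 1 = char_ext chi t.
  rewrite -chi2 nroots_char // chi2 !big_ord_recl big_ord0 /=.
  by rewrite addr0 addrC addKr.
by rewrite !n2E char_extM.
Qed.

Lemma nroots2_sqr (L : finFieldType) (u : L) :
  odd #|L| -> u != 0 -> (nroots 2 u - 1) ^+ 2 = 1.
Proof.
move=> L_odd u0; rewrite expr2 -nroots2M // -expr2 nroots_power //.
  by ring.
exact: odd_card_dvd2.
Qed.

(** With nroots 3 = 1 + chi + chi^2, the four products chi^i(s) chi^j(u) with
    i, j in {1, 2} pair up as chi + chi^2 at u/s and at u/s^2, because
    chi^-1 = chi^2 and chi(s^-2) = chi(s). *)
Lemma nroots3M (L : finFieldType) (chi : 'CF([set: {unit L}])) (s u : L) :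
    chi \is a linear_char -> #[chi]%CF = 3%N -> s != 0 ->
  nroots 3 s * nroots 3 u
    = nroots 3 s + nroots 3 u + nroots 3 (u / s) + nroots 3 (u / s ^+ 2) - 3%:R.
Proof.
move=> chi_lin chi3 s0; set X := char_ext chi.
have n3E t : nroots 3 t = 1 + X t + X t ^+ 2.
  by rewrite -chi3 nroots_char // chi3 !big_ord_recl big_ord0 /= addr0 addrA.
have Xs3 : X s ^+ 3 = 1 by rewrite -chi3 char_ext_order.
have XV : X s^-1 = X s ^+ 2.
  have Xs0 : X s != 0.
    by apply: contra_eq_neq Xs3 => ->; rewrite expr0n eq_sym oner_eq0.
  by apply: (mulfI Xs0); rewrite -exprS Xs3 -char_extM // divff // char_ext1.
have XV2 : X (s ^+ 2)^-1 = X s.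
  by rewrite -exprVn /X char_extX // -/X XV -exprM (exprS _ 3) Xs3 mulr1.
have XM : {morph X : x y / x * y} by exact: char_extM.
rewrite !n3E !XM XV XV2.
have Xs4 : X s ^+ 2 * X s ^+ 2 = X s by rewrite -exprD (exprS _ 3) Xs3 mulr1.
rewrite !exprMn Xs4; ring.
Qed.

(** * Character sums over the affine curves *)

Lemma sum_comp_expr (L : finFieldType) (d : nat) (h : L -> algC) :
  \sum_y h (y ^+ d) = \sum_t nroots d t * h t.
Proof.
rewrite (partition_big (fun y : L => y ^+ d) predT) //=; apply: eq_bigr => t _.
rewrite (eq_bigr (fun=> h t)) => [|y /eqP-> //].
rewrite sumr_const /nroots mulr_natl; congr (_ *+ _).
by apply: eq_card => y; rewrite !inE.
Qed.

Lemma sum_nroots (L : finFieldType) (d : nat) :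
  \sum_(t : L) nroots d t = #|L|%:R.
Proof.
under eq_bigr do rewrite -[nroots d _]mulr1.
by rewrite -(sum_comp_expr d (fun=> 1)) sumr_const.
Qed.

Lemma nrootsE (L : finFieldType) (d : nat) (t : L) :
  nroots d t = \sum_y (y ^+ d == t)%:R.
Proof.
rewrite /nroots -sum1_card natr_sum big_mkcond /=.
by apply: eq_bigr => y _; rewrite inE; case: eqP.
Qed.

Lemma card_nroots_curve (L : finFieldType) (d : nat) (h : L -> L) :
  #|[set p : L * L | p.2 ^+ d == h p.1]|%:R = \sum_x nroots d (h x).
Proof.
rewrite -sum1_card natr_sum big_mkcond /=.
under [RHS]eq_bigr do rewrite nrootsE.
rewrite pair_big /=; apply: eq_bigr => p _.
by rewrite inE; case: eqP.
Qed.

(** Both sides count the affine points of one curve, projected to either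
    axis. *)
Lemma sum_nroots_swap (L : finFieldType) (d e : nat) (h k : L -> L) :
    (forall x y, (y ^+ d == h x) = (x ^+ e == k y)) ->
  \sum_x nroots d (h x) = \sum_y nroots e (k y).
Proof.
move=> hk; under eq_bigr do rewrite nrootsE; rewrite exchange_big /=.
by apply: eq_bigr => y _; rewrite nrootsE; apply: eq_bigr => x _; rewrite hk.
Qed.

Lemma sum_neq0_inv (L : finFieldType) (h : L -> algC) :
  \sum_(s | s != 0) h s^-1 = \sum_(s | s != 0) h s.
Proof.
rewrite [RHS](reindex_inj invr_inj) /=.
by apply: eq_bigl => s; rewrite invr_eq0.
Qed.

(** For each x the equation a s^2 - k(x) s + b = 0 has discriminant
    k(x)^2 - 4ab; completing the square, y = 2 a s - k(x), matches its solutions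
    s with the square roots y of the discriminant. *)
Lemma sum_nroots_quadratic (L : finFieldType) (a b : L) (k : L -> L) :
    odd #|L| -> a != 0 ->
  \sum_x nroots 2 (k x ^+ 2 - 4%:R * a * b)
    = \sum_x \sum_s (a * s ^+ 2 + b == s * k x)%:R.
Proof.
move=> /natf2_neq0 two0 a0; apply: eq_bigr => x _; rewrite nrootsE.
have aff_inj : injective (fun s : L => 2%:R * a * s - k x).
  by move=> s s' /addIr/mulfI; apply; rewrite mulf_neq0.
rewrite (reindex_inj aff_inj) /=; apply: eq_bigr => s _; congr (_ %:R : algC).
congr (nat_of_bool _); rewrite -subr_eq0 -[RHS]subr_eq0.
rewrite (_ : _ - _ = 2%:R ^+ 2 * a * (a * s ^+ 2 + b - s * k x)); last by ring.
by rewrite !mulf_eq0 (negPf two0) (negPf a0).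
Qed.

Lemma sum_neq0 (L : finFieldType) (h : L -> algC) :
  \sum_(s | s != 0) h s = \sum_s h s - h 0.
Proof. by rewrite [in RHS](bigD1 0) //= addrC addrK. Qed.

(** Substituting v = w^2 weights v^3 - c by nroots 2 v = 1 + e v, where e is the
    quadratic character. The weight 1 gives the curve y^2 = v^3 - c. The weight
    e gives, up to the total sum of e, which is 0, the sum of e(v) e(v^3 - c), and
    v (v^3 - c) is v^4 times 1 - c/v^3, whence the curve y^2 = 1 - c x^3 with
    x = 1/v. *)
Lemma sum_nroots2_sextic (L : finFieldType) (c : L) :
    odd #|L| ->
  \sum_w nroots 2 (w ^+ 6 - c)
    = \sum_v nroots 2 (v ^+ 3 - c) + \sum_x nroots 2 (1 - c * x ^+ 3)
      - #|L|%:R - 1.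
Proof.
move=> L_odd; have two_gt0 : (0 < 2)%N by [].
have n21 : nroots 2 (1 : L) = 2%:R.
  by rewrite -(expr1n L 2) nroots_power ?oner_eq0 ?odd_card_dvd2.
under eq_bigr do rewrite (exprM _ 2 3).
rewrite (sum_comp_expr 2 (fun v => nroots 2 (v ^+ 3 - c))).
have [e eE] : exists e : L -> algC, forall t, e t = nroots 2 t - 1.
  by exists (fun t => nroots 2 t - 1).
have eM u v : e (u * v) = e u * e v by rewrite !eE nroots2M.
have sum_e : \sum_v e v = 0.
  by under eq_bigr do rewrite eE; rewrite sumrB sum_nroots sumr_const subrr.
have prodE v : nroots 2 v * nroots 2 (v ^+ 3 - c)
    = nroots 2 (v ^+ 3 - c) + e v + e v * e (v ^+ 3 - c).
  by rewrite !eE; ring.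
under eq_bigr do rewrite prodE.
rewrite 2!big_split /= sum_e addr0 -!addrA; congr (_ + _).
(* The sum over x = 1/v misses x = 0, where 1 - c x^3 = 1 has e-value 1. *)
rewrite (bigD1 0) //= [e 0]eE nroots0 // subrr mul0r add0r.
rewrite (eq_bigr (fun v => nroots 2 (1 - c * v^-1 ^+ 3) - 1)) => [|v v0].
  rewrite (sum_neq0_inv (fun x => nroots 2 (1 - c * x ^+ 3) - 1)) sum_neq0.
  by rewrite sumrB sumr_const expr0n mulr0 subr0 n21; ring.
have -> : v ^+ 3 - c = v * v * (v * (1 - c * v^-1 ^+ 3)) by field.
have e2 : e v * e v = 1 by rewrite -expr2 eE nroots2_sqr.
by rewrite !eM e2 mul1r mulrA e2 mul1r eE.
Qed.

(** Both sides count the pairs (s, w) with a s^2 + b = s w^3; as b <> 0, such a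
    pair has s <> 0 automatically. *)
Lemma sum_nroots3_div (L : finFieldType) (a b : L) :
    odd #|L| -> a != 0 -> b != 0 ->
  \sum_(s | s != 0) nroots 3 ((a * s ^+ 2 + b) / s)
    = \sum_w nroots 2 (w ^+ 6 - 4%:R * a * b).
Proof.
move=> L_odd a0 b0; under [RHS]eq_bigr do rewrite (exprM _ 3 2).
rewrite (sum_nroots_quadratic b (fun x => x ^+ 3)) // exchange_big /=.
rewrite [RHS](bigD1 0) //= [X in _ = X + _]big1 ?add0r => [|x _]; last first.
  by rewrite expr0n mulr0 add0r mul0r (negPf b0).
apply: eq_bigr => s s0; rewrite nrootsE; apply: eq_bigr => x _.
congr (_ %:R : algC); congr (nat_of_bool _).
by rewrite eq_sym -(inj_eq (mulfI s0)) mulrCA divff // mulr1.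
Qed.

(** The relation between the affine counts, obtained by summing [nroots3M] over
    s = x^3 <> 0 with u = a s^2 + b. *)
Lemma sum_nroots3_sextic (L : finFieldType) (chi : 'CF([set: {unit L}]))
    (a b : L) :
    chi \is a linear_char -> #[chi]%CF = 3%N ->
    odd #|L| -> a != 0 -> b != 0 ->
  \sum_x nroots 3 (a * x ^+ 6 + b)
    = \sum_y nroots 3 (a * y ^+ 2 + b) + \sum_y nroots 3 (b * y ^+ 2 + a)
      + \sum_x nroots 2 (x ^+ 3 - 4%:R * a * b)
      + \sum_x nroots 2 (1 - 4%:R * a * b * x ^+ 3)
      - 3%:R * #|L|%:R + 1 - nroots 3 a.
Proof.
move=> chi_lin chi3 L_odd a0 b0.
under eq_bigr do rewrite (exprM _ 3 2).
rewrite (sum_comp_expr 3 (fun s => nroots 3 (a * s ^+ 2 + b))).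
rewrite (bigD1 0) //= nroots0 // mul1r expr0n mulr0 add0r.
rewrite (eq_bigr (fun s => nroots 3 s + nroots 3 (a * s ^+ 2 + b)
    + nroots 3 ((a * s ^+ 2 + b) / s) + nroots 3 (b * s^-1 ^+ 2 + a) - 3%:R))
  => [|s s0]; last first.
  rewrite (nroots3M _ chi_lin) //; congr (_ + _ + nroots 3 _ - _).
  by field.
rewrite sumrB !big_split /= sum_nroots3_div // sum_nroots2_sextic //.
rewrite (sum_neq0_inv (fun x => nroots 3 (b * x ^+ 2 + a))) !sum_neq0.
rewrite sum_nroots sumr_const nroots0 // expr0n !mulr0 !add0r -mulr_natl.
by ring.
Qed.

(** * Points of the projective closure of a plane curve *)

Definition point2 (L : fieldType) (p : L * L) (i : 'I_2) : L :=
  if i == ord0 then p.1 else p.2.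

Definition row3 (L : fieldType) (x y z : L) : 'rV[L]_3 :=
  \row_i [:: x; y; z]`_i.

Lemma row3_ex (L : fieldType) (v : 'rV[L]_3) : exists x y z, v = row3 x y z.
Proof.
exists (v ord0 ord0), (v ord0 (inord 1)), (v ord0 ord_max).
apply/rowP=> i; rewrite mxE; case: i => -[|[|[|//]]] lt_i /=;
  congr (v _ _); apply: val_inj; rewrite //= inordK //.
Qed.

Lemma row3_inj (L : fieldType) (x y z x' y' z' : L) :
  row3 x y z = row3 x' y' z' -> [/\ x = x', y = y' & z = z'].
Proof.
move/rowP=> eq_v; move: (eq_v ord0) (eq_v (inord 1)) (eq_v ord_max).
by rewrite !mxE /= inordK.
Qed.

Lemma scale_row3 (L : fieldType) (c x y z : L) :
  c *: row3 x y z = row3 (c * x) (c * y) (c * z).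
Proof.
by apply/rowP=> i; rewrite !mxE; case: i => -[|[|[|//]]].
Qed.

Lemma row3_eq0 (L : fieldType) (x y z : L) :
  (row3 x y z == 0) = [&& x == 0, y == 0 & z == 0].
Proof.
have -> : 0 = row3 0 0 0 :> 'rV[L]_3.
  by apply/rowP=> i; rewrite !mxE; case: i => -[|[|[|//]]].
by apply/eqP/and3P=> [/row3_inj[-> -> ->]|[/eqP-> /eqP-> /eqP->]].
Qed.

Lemma proj_pointP (L : finFieldType) (v w : 'rV[L]_3) :
  reflect (exists2 c, c != 0 & w = c *: v) (proj_point v == proj_point w).
Proof.
apply: (iffP eqP) => [eq_vw|[c c0 ->]].
  have : w \in proj_point w.
    by apply/imsetP; exists 1; rewrite ?inE ?oner_eq0 ?scale1r.
  by rewrite -eq_vw => /imsetP[c]; rewrite inE; exists c.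
apply/setP=> u; apply/imsetP/imsetP=> -[d]; rewrite inE => d0 ->.
  by exists (d / c); rewrite ?inE ?mulf_neq0 ?invr_eq0 // scalerA divfK.
by exists (d * c); rewrite ?inE ?mulf_neq0 // scalerA.
Qed.

Lemma eval_homogenize (F L : fieldType) (iota : {rmorphism F -> L})
    (f : {mpoly F[2]}) (x y z : L) :
  (map_mpoly iota (homogenize f)).@[fun i => row3 x y z ord0 i]
    = \sum_(m <- msupp f)
        iota f@_m * (x ^+ m ord0 * y ^+ m ord_max
                     * z ^+ ((msize f).-1 - mdeg m)).
Proof.
rewrite /homogenize [map_mpoly iota _]rmorph_sum raddf_sum /=.
apply: eq_bigr => m _.
rewrite map_mpolyZ mevalZ !rmorphM /= !rmorphXn /= !big_ord_recl big_ord0 mulr1.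
rewrite !rmorphM /= !rmorphXn /= !map_mpolyX !mevalXU !mxE /=.
by rewrite (_ : lift ord0 ord0 = ord_max) //; apply: val_inj.
Qed.

Lemma eval_affine (F L : fieldType) (iota : {rmorphism F -> L})
    (f : {mpoly F[2]}) (p : L * L) :
  (map_mpoly iota f).@[point2 p]
    = \sum_(m <- msupp f) iota f@_m * (p.1 ^+ m ord0 * p.2 ^+ m ord_max).
Proof.
rewrite {1}[f]mpolyE [map_mpoly iota _]rmorph_sum raddf_sum /=.
apply: eq_bigr => m _.
rewrite map_mpolyZ mevalZ map_mpolyX mevalX !big_ord_recl big_ord0 mulr1.
by rewrite (_ : lift ord0 ord0 = ord_max) //; apply: val_inj.
Qed.

(** Each term of the homogenization has total degree (msize f).-1, so it is
    z ^+ (msize f).-1 times the term of f at (x/z, y/z). *)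
Lemma on_closure_affine (F : fieldType) (L : finFieldType)
    (iota : {rmorphism F -> L}) (f : {mpoly F[2]}) (x y z : L) : z != 0 ->
  on_closure iota f (row3 x y z)
    = ((map_mpoly iota f).@[point2 (x / z, y / z)] == 0).
Proof.
move=> z0; rewrite /on_closure eval_homogenize eval_affine.
rewrite -[RHS](inj_eq (mulfI (expf_neq0 (msize f).-1 z0))) mulr0.
congr (_ == 0).
rewrite mulr_sumr !big_seq; apply: eq_bigr => m /msize_mdeg_lt lt_m.
have le_m : (mdeg m <= (msize f).-1)%N by case: (msize f) lt_m.
rewrite [RHS]mulrCA /= !expr_div_n; congr (_ * _).
rewrite -{2}(subnK le_m) exprD mdegE !big_ord_recl big_ord0 addn0 exprD.
rewrite (_ : lift ord0 ord0 = ord_max); last exact: val_inj.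
have := expf_neq0 (m ord_max) z0; have := expf_neq0 (m ord0) z0.
move: (z ^+ m ord0) (z ^+ m ord_max) (z ^+ (_ - _)) => u v w u0 v0.
by field; rewrite u0 v0.
Qed.

(** On the line at infinity only the terms of top degree N survive, and c x^N is
    the only one. *)
Lemma on_closure_infty (F : fieldType) (L : finFieldType)
    (iota : {rmorphism F -> L}) (N : nat) (c : F) (r : {mpoly F[2]}) (x y : L) :
    (0 < N)%N -> c != 0 -> (msize r <= N)%N ->
  on_closure iota (c *: 'X_ord0 ^+ N + r) (row3 x y 0) = (x == 0).
Proof.
move=> N_gt0 c0 r_small; set f := _ + r; rewrite /on_closure eval_homogenize.
pose M : 'X_{1..2} := (U_(ord0) *+ N)%MM.
have degM : mdeg M = N by rewrite mdegMn mdeg1 mul1n.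
have fE m : (N <= mdeg m)%N -> f@_m = c * (m == M)%:R.
  move=> le_m; rewrite mcoeffD mcoeffZ mcoeffXn eq_sym.
  by rewrite (memN_msupp_eq0 (msize_mdeg_ge (leq_trans r_small le_m))) addr0.
have fM : f@_M = c by rewrite fE ?degM // eqxx mulr1.
have f_M : M \in msupp f by rewrite mcoeff_msupp fM.
have size_f : msize f = N.+1.
  apply/anti_leq/andP; split; last by rewrite -degM msize_mdeg_lt.
  apply: leq_trans (mmeasureD_le _ _ _) _.
  rewrite geq_max [X in _ && X]ltnW // andbT.
  by apply: leq_trans (msizeZ_le _ _) _; rewrite mpolyXn msizeX degM.
rewrite (bigD1_seq M) //= big1_seq ?addr0 => [|m /andP[m_neq m_f]].
  rewrite fM size_f degM subnn expr0 mulr1 !mulmnE !mnm1E /= mul0n mul1n.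
  rewrite expr0 mulr1.
  by rewrite mulf_eq0 fmorph_eq0 (negPf c0) expf_eq0 N_gt0.
have lt_m : (mdeg m < N)%N.
  rewrite ltnNge; apply/negP=> /fE; rewrite (negPf m_neq) mulr0 => /eqP.
  by rewrite -[_ == 0]negbK -mcoeff_msupp m_f.
by rewrite size_f /= expr0n subn_eq0 leqNgt lt_m !mulr0.
Qed.

(** A point with z <> 0 has a unique representative (x : y : 1), and the only
    point at infinity is (0 : 1 : 0). *)
Lemma num_points_affine (F : fieldType) (L : finFieldType)
    (iota : {rmorphism F -> L}) (N : nat) (c : F) (r : {mpoly F[2]}) :
    (0 < N)%N -> c != 0 -> (msize r <= N)%N ->
  let f := c *: 'X_ord0 ^+ N + r in
  num_points iota f
    = #|[set p | (map_mpoly iota f).@[point2 p] == 0]|.+1.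
Proof.
move=> N_gt0 c0 r_small f; set Z := [set p | _].
pose aff (p : L * L) := proj_point (row3 p.1 p.2 1).
rewrite /num_points.
rewrite (_ : [set _ | _ in _] = proj_point (row3 0 1 0) |: aff @: Z).
  rewrite cardsU1 card_imset => [|[x y] [x' y'] /eqP/proj_pointP[d _]].
    case: imsetP => // -[p _ /eqP/proj_pointP[d d0]].
    by rewrite scale_row3 mulr0 => /row3_inj[_ _ /eqP]; rewrite oner_eq0.
  by rewrite scale_row3 mulr1 => /row3_inj[/= -> -> <-]; rewrite !mul1r.
apply/setP=> V; rewrite in_setU1; apply/imsetP/orP=> [[v]|].
  have [x [y [z ->]]] := row3_ex v; rewrite inE row3_eq0 => /andP[v0 + ->].
  have [z0|z0] := eqVneq z 0.
    move: v0; rewrite z0 eqxx andbT on_closure_infty // => + /eqP x0.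
    rewrite x0 eqxx /= => y0; left; apply/proj_pointP; exists y^-1.
      by rewrite invr_eq0.
    by rewrite scale_row3 !mulr0 mulVf.
  rewrite on_closure_affine // => f0; right.
  apply/imsetP; exists (x / z, y / z).
    by rewrite inE.
  apply/eqP/proj_pointP; exists z^-1; first by rewrite invr_eq0.
  by rewrite scale_row3 ![z^-1 * _]mulrC divff.
case=> [/eqP->|/imsetP[p]].
  exists (row3 0 1 0) => //.
  by rewrite inE row3_eq0 on_closure_infty // eqxx oner_eq0.
rewrite inE => p0 ->; exists (row3 p.1 p.2 1) => //.
rewrite inE row3_eq0 oner_eq0 !andbF on_closure_affine ?oner_eq0 //=.
by rewrite !divr1 -surjective_pairing.
Qed.

Lemma num_points_superelliptic (F : fieldType) (L : finFieldType)
    (iota : {rmorphism F -> L}) (d N : nat) (a b : F) :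
    (d < N)%N -> a != 0 ->
  (num_points iota ('X_ord_max ^+ d - (a *: 'X_ord0 ^+ N + b%:MP)))%:R
    = 1 + \sum_x nroots d (iota a * x ^+ N + iota b).
Proof.
move=> lt_dN a0; rewrite opprD addrCA -scaleNr.
have r_small : (msize ('X_ord_max ^+ d - b%:MP : {mpoly F[2]}) <= N)%N.
  apply: leq_trans (mmeasureD_le _ _ _) _; rewrite geq_max mpolyXn msizeX.
  rewrite mmeasureN mmeasureC mdegMn mdeg1 mul1n lt_dN.
  by apply: leq_trans (leq_b1 _) (leq_ltn_trans _ lt_dN).
rewrite num_points_affine ?oppr_eq0 //; last exact: leq_ltn_trans lt_dN.
rewrite -add1n natrD -(card_nroots_curve d (fun x => iota a * x ^+ N + iota b)).
congr (_ + _%:R); apply: eq_card => p; rewrite !inE.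
rewrite -[RHS]subr_eq0; congr (_ == 0).
rewrite !rmorphD /= !rmorphN /= map_mpolyZ !rmorphXn /= !map_mpolyX map_mpolyC.
rewrite mevalZ !rmorphXn /= !mevalXU mevalC rmorphN.
by rewrite /point2 /=; ring.
Qed.

Lemma num_points_cubic (F : fieldType) (L : finFieldType)
    (iota : {rmorphism F -> L}) (a d : F) : a != 0 ->
  (num_points iota (cubic_curve a 0 0 d))%:R
    = 1 + \sum_x nroots 2 (iota a * x ^+ 3 + iota d).
Proof.
by move=> a0; rewrite /cubic_curve !scale0r !addr0 num_points_superelliptic.
Qed.

(** The equation y^2 = a^-1 x^3 - b a^-1 is x^3 = a y^2 + b solved for y^2. *)
Lemma num_points_cubic_inv (F : fieldType) (L : finFieldType)
    (iota : {rmorphism F -> L}) (a b : F) : a != 0 ->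
  (num_points iota (cubic_curve a^-1 0 0 (- (b * a^-1))))%:R
    = 1 + \sum_y nroots 3 (iota a * y ^+ 2 + iota b).
Proof.
move=> a0; rewrite num_points_cubic ?invr_eq0 //; congr (_ + _).
have ia0 : iota a != 0 by rewrite fmorph_eq0.
apply: sum_nroots_swap => x y.
rewrite rmorphN rmorphM fmorphV -(inj_eq (mulfI ia0)) -subr_eq0 -[RHS]subr_eq0.
rewrite -[RHS]oppr_eq0; congr (_ == 0).
by field.
Qed.

Theorem theorem1p2 (F : finFieldType) (a b : F) (n : nat)
    (L : finFieldType) (iota : {rmorphism F -> L})
    (chi3 : 'CF([set: {unit L}])) (w1 w2 w3 w4 : algC)
    (q_odd : odd #|F|) (q_mod3 : #|F| = 1 %[mod 3])
    (a_neq0 : a != 0) (b_neq0 : b != 0) (n_gt0 : (0 < n)%N)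
    (cardL : #|L| = (#|F| ^ n)%N)
    (chi3_lin : chi3 \is a linear_char) (chi3_order : #[chi3]%CF = 3%N)
    (w1P : is_omega a^-1 0 0 (- (b * a^-1)) w1)
    (w2P : is_omega b^-1 0 0 (- (a * b^-1)) w2)
    (w3P : is_omega 1 0 0 (- (4%:R * a * b)) w3)
    (w4P : is_omega (- (4%:R * a * b)) 0 0 1 w4) :
  (num_points iota (sextic_curve a b))%:R
    = (#|F| ^ n)%:R + 1
      - w1 ^+ n - w1^* ^+ n - w2 ^+ n - w2^* ^+ n
      - w3 ^+ n - w3^* ^+ n - w4 ^+ n - w4^* ^+ n
      - char_ext chi3 (iota a) - char_ext chi3 (iota a) ^+ 2.
Proof.
have L_odd : odd #|L| by rewrite cardL oddX q_odd orbT.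
have ia0 : iota a != 0 by rewrite fmorph_eq0.
have ib0 : iota b != 0 by rewrite fmorph_eq0.
have four_ab0 : 4%:R * a * b != 0.
  rewrite -(fmorph_eq0 iota) !rmorphM rmorph_nat (natrM _ 2 2) !mulf_neq0 //.
    exact: natf2_neq0.
  exact: natf2_neq0.
have ia4b : iota (- (4%:R * a * b)) = - (4%:R * iota a * iota b).
  by rewrite rmorphN !rmorphM rmorph_nat.
have E1 : 1 + \sum_y nroots 3 (iota a * y ^+ 2 + iota b)
    = (#|F| ^ n)%:R + 1 - w1 ^+ n - w1^* ^+ n.
  by rewrite -num_points_cubic_inv //; case: w1P => _ _; apply.
have E2 : 1 + \sum_y nroots 3 (iota b * y ^+ 2 + iota a)
    = (#|F| ^ n)%:R + 1 - w2 ^+ n - w2^* ^+ n.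
  by rewrite -num_points_cubic_inv //; case: w2P => _ _; apply.
have E3 : 1 + \sum_x nroots 2 (x ^+ 3 - 4%:R * iota a * iota b)
    = (#|F| ^ n)%:R + 1 - w3 ^+ n - w3^* ^+ n.
  case: w3P => _ _ /(_ n L iota n_gt0 cardL) <-.
  rewrite num_points_cubic ?oner_eq0 // rmorph1 ia4b.
  by under [in RHS]eq_bigr do rewrite mul1r.
have E4 : 1 + \sum_x nroots 2 (1 - 4%:R * iota a * iota b * x ^+ 3)
    = (#|F| ^ n)%:R + 1 - w4 ^+ n - w4^* ^+ n.
  case: w4P => _ _ /(_ n L iota n_gt0 cardL) <-.
  rewrite num_points_cubic ?oppr_eq0 // rmorph1 ia4b.
  by under [in RHS]eq_bigr do rewrite mulNr addrC.
rewrite num_points_superelliptic // (sum_nroots3_sextic chi3_lin) //.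
have -> : nroots 3 (iota a)
    = 1 + char_ext chi3 (iota a) + char_ext chi3 (iota a) ^+ 2.
  rewrite -chi3_order nroots_char // chi3_order !big_ord_recl big_ord0.
  by rewrite addr0 addrA.
rewrite (canRL (addKr 1) E1) (canRL (addKr 1) E2).
rewrite (canRL (addKr 1) E3) (canRL (addKr 1) E4) cardL.
by ring.
Qed.
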